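(* Let $n\ge 3$ be an integer. A positive integer $m$ is the sum of three $n$-gonal numbers of positive rank (that is, $m=p^{n}_{a}+p^{n}_{b}+p^{n}_{c}$ for some integers $a,b,c\ge 1$) if and only if there is a vertex $v_{ij}$ ($i,j\ge 0$) lying in a non-trivial component of the graph $\Gamma_{p^{n}_{k}}$ such that $m$ represents $v_{ij}$ in $\mathscr{R}_{n}$, i.e. $m=3+(n-2)i+(n-1)j$.
   Context: For $n\ge 3$ the $k$-th $n$-gonal number (polygonal number of rank $k$) is $p^{n}_{k}=\frac12[(n-2)k^{2}-(n-4)k]$. In particular $p^{3}_{k}=\frac{k(k+1)}{2}$, with $p^{3}_{0}=p^{3}_{-1}=0$. The points are symbols $v_{ij}$ indexed by pairs of integers $i,j\ge 0$ (as a poset $\mathscr{R}$, the points with fixed $j$ form the infinite chain $v_{0j}<v_{1j}<v_{2j}<\cdots$, and different chains are incomparable). In the representation $\mathscr{R}_{n}$ the point $v_{ij}$ is represented by the number $n_{ij}=3+(n-2)i+(n-1)j$. The graph $\Gamma_{p^{n}_{k}}$ has vertex set $\{v_{ij}: i,j\ge 0\}$, and its arrows are exactly those joining consecutive vertices of the following paths (where $v_{(x)(y)}$ denotes the vertex with first index $x$ and second index $y$): (1) the left boundary path, whose vertices in order are $v_{(p^{3}_{i-1})(i)}$, $i=0,1,2,\dots$; (2) for all integers $i_{0},j\ge 0$, the path $P$ whose vertices in order are $v_{(p^{3}_{i_{0}-1}+p^{3}_{k-1})(i_{0}+k)}$, $k=0,1,\dots,j$; (3) for all integers $i_{0},j\ge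 0$, the path $P'$ whose vertices in order are $v_{(p^{3}_{i_{0}-1}+p^{3}_{j-1}+p^{3}_{l-1})(i_{0}+j+l)}$, $l=0,1,\dots,j$. A component of the graph means a connected component of the underlying undirected graph; it is non-trivial if it contains at least one arrow (i.e. it is not a single isolated vertex). *)

(* Defs.v *)
From mathcomp Require Import all_boot all_order all_algebra.
From mathcomp Require Import zify ring lra.
From Stdlib Require Import Relation_Operators.

Set Implicit Arguments.
Unset Strict Implicit.
Unset Printing Implicit Defensive.

Import Order.TTheory GRing.Theory Num.Theory.
Local Open Scope ring_scope.

(* The integer quotient is exact: see polygonal_exact. *)
Definition polygonal (n k : int) : int :=
  (((n - 2) * k ^+ 2 - (n - 4) * k) %/ 2)%Z.

Lemma polygonal_exact (n k : int) :
  2 * polygonal n k = (n - 2) * k ^+ 2 - (n - 4) * k.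
Proof.
rewrite mulrC; apply: divzK.
have [q [Hq|Hq]] : exists q : int, k = 2 * q \/ k = 2 * q + 1.
  by exists (k %/ 2)%Z; lia.
- apply/dvdzP; exists ((n - 2) * 2 * q ^+ 2 - (n - 4) * q); rewrite Hq; ring.
- apply/dvdzP; exists ((n - 2) * (2 * q ^+ 2 + 2 * q) - (n - 4) * q + 1).
  rewrite Hq; ring.
Qed.

(* The number p^3_{k-1}, as an index; it is nonnegative for k >= 0 (see
   triangular_predE), so taking the absolute value loses nothing. *)
Definition triangular_pred (k : nat) : nat := absz (polygonal 3 (k%:Z - 1)).

Lemma triangular_predE (k : nat) :
  (triangular_pred k)%:Z = polygonal 3 (k%:Z - 1).
Proof.
have H := polygonal_exact 3 (k%:Z - 1).
have H0 : 0 <= polygonal 3 (k%:Z - 1) by case: k H => [|k] H; nia.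
by rewrite /triangular_pred; lia.
Qed.

(* The pair (i, j) stands for the point v_{ij}. *)
Definition vertex : Type := (nat * nat)%type.

(* The number n_{ij} representing v_{ij} in R_n. *)
Definition representation (n : int) (v : vertex) : int :=
  3 + (n - 2) * v.1%:Z + (n - 1) * v.2%:Z.

Definition left_boundary (i : nat) : vertex := (triangular_pred i, i).

Definition pathP (i0 k : nat) : vertex :=
  ((triangular_pred i0 + triangular_pred k)%N, (i0 + k)%N).

Definition pathP' (i0 j l : nat) : vertex :=
  ((triangular_pred i0 + triangular_pred j + triangular_pred l)%N,
   (i0 + j + l)%N).

(* The path P attached to (i0, j) is pathP i0 0, ..., pathP i0 j, and the path
   P' attached to (i0, j) is pathP' i0 j 0, ..., pathP' i0 j j. *)
Inductive arrow : vertex -> vertex -> Prop :=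
| arrow_left_boundary (i : nat) :
    arrow (left_boundary i) (left_boundary i.+1)
| arrow_P (i0 j k : nat) :
    (k < j)%N -> arrow (pathP i0 k) (pathP i0 k.+1)
| arrow_P' (i0 j l : nat) :
    (l < j)%N -> arrow (pathP' i0 j l) (pathP' i0 j l.+1).

(* The connected component of v in the underlying undirected graph. *)
Definition component (v : vertex) : vertex -> Prop :=
  clos_refl_sym_trans vertex arrow v.

Definition nontrivial_component (C : vertex -> Prop) : Prop :=
  exists u w : vertex, [/\ C u, C w & arrow u w].

(* Main.v *)
(* Writing a polygonal number of positive rank as p^n_{a+1}
   = 1 + (n-2) p^3_{a-1} + (n-1) a, a sum of three of them represents the vertex
   pathP' a b c. Up to exchanging b and c this vertex lies on a path P' or on the
   left boundary; conversely every endpoint of an arrow has this form, hence so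
   does every vertex of a non-trivial component. *)
Require Import Defs.
From mathcomp Require Import all_boot all_order all_algebra.
From mathcomp Require Import zify ring.
From Stdlib Require Import Relation_Operators.

Import Order.TTheory GRing.Theory Num.Theory.
Local Open Scope ring_scope.

(** Both quotients by 2 are exact, so the identity is checked after doubling. *)
Lemma polygonal_succ (n : int) (a : nat) :
  polygonal n (a%:Z + 1) = 1 + (n - 2) * (triangular_pred a)%:Z + (n - 1) * a%:Z.
Proof.
have Hn := polygonal_exact n (a%:Z + 1).
have H3 := polygonal_exact 3 (a%:Z - 1).
rewrite -triangular_predE in H3.
have E : (n - 2) * (2 * (triangular_pred a)%:Z) =
         (n - 2) * ((3 - 2) * (a%:Z - 1) ^+ 2 - (3 - 4) * (a%:Z - 1)).
  by rewrite H3.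
apply: (@mulfI int 2) => //; rewrite Hn.
transitivity (2 + (n - 2) * (2 * (triangular_pred a)%:Z) + 2 * (n - 1) * a%:Z).
  by rewrite E; ring.
by ring.
Qed.

Lemma triangular_pred0 : triangular_pred 0 = 0%N.
Proof. by []. Qed.

(** The three constants 1 from [polygonal_succ] add up to the 3 of [representation]; the other terms
    are linear in the two indices. *)
Lemma representation_pathP' (n : int) (a b c : nat) :
  representation n (pathP' a b c) =
  polygonal n (a%:Z + 1) + polygonal n (b%:Z + 1) + polygonal n (c%:Z + 1).
Proof. by rewrite !polygonal_succ /representation /= !PoszD; ring. Qed.

Lemma pathP'C (a b c : nat) : pathP' a b c = pathP' a c b.
Proof. by rewrite /pathP' addnAC [(a + b + c)%N]addnAC. Qed.

Lemma pathP'0 (a b : nat) : pathP' a b 0 = Defs.pathP a b.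
Proof. by rewrite /pathP' triangular_pred0 !addn0. Qed.

Lemma pathP0 (a : nat) : Defs.pathP a 0 = left_boundary a.
Proof. by rewrite /Defs.pathP triangular_pred0 !addn0. Qed.

Lemma left_boundary_pathP' (a : nat) : left_boundary a = pathP' a 0 0.
Proof. by rewrite pathP'0 pathP0. Qed.

Lemma nontrivial_pathP' (a b c : nat) :
  nontrivial_component (component (pathP' a b c)).
Proof.
wlog le_cb : b c / (c <= b)%N => [H|].
  by case: (leqP c b) => [|/ltnW] /H //; rewrite pathP'C.
move: le_cb; rewrite leq_eqVlt => /predU1P[->{c}|lt_cb].
  case: b => [|b].
    have A := arrow_left_boundary a; rewrite -left_boundary_pathP'.
    by exists (left_boundary a), (left_boundary a.+1); split=> //;
      [exact: rst_refl | exact: rst_step].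
  (* With equal positive ranks the vertex ends its path P', so the arrow entering it is taken. *)
  have A := @arrow_P' a b.+1 b (ltnSn b).
  exists (pathP' a b.+1 b), (pathP' a b.+1 b.+1); split=> //.
    exact/rst_sym/rst_step.
  exact: rst_refl.
have A := @arrow_P' a b c lt_cb.
by exists (pathP' a b c), (pathP' a b c.+1); split=> //;
  [exact: rst_refl | exact: rst_step].
Qed.

Definition on_pathP' (v : vertex) : Prop := exists a b c, v = pathP' a b c.

Lemma arrow_on_pathP' (u w : vertex) : arrow u w -> on_pathP' u /\ on_pathP' w.
Proof.
case=> [i|i0 j k _|i0 j l _].
- by rewrite !left_boundary_pathP'; split; do 3!eexists.
- by rewrite -!pathP'0; split; do 3!eexists.
- by split; do 3!eexists.
Qed.

(** Both ends of any arrow have the form [pathP'], and an equivalence survives the reflexive,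
    symmetric and transitive closure. *)
Lemma component_on_pathP' (v w : vertex) :
  component v w -> on_pathP' v <-> on_pathP' w.
Proof. by elim=> [x y /arrow_on_pathP'|x|x y _|x y z _ + _]; tauto. Qed.

(** The source of an arrow in the component has the form [pathP'], which is carried along the
    component back to [v]. *)
Lemma nontrivial_on_pathP' (v : vertex) :
  nontrivial_component (component v) -> on_pathP' v.
Proof.
by case=> u [w [/component_on_pathP' vu _ /arrow_on_pathP'[/vu]]].
Qed.

Theorem theorem11 (n : int) (hn : 3 <= n) (m : int) (hm : 0 < m) :
  (exists a b c : int,
     [/\ 1 <= a, 1 <= b, 1 <= c
       & m = polygonal n a + polygonal n b + polygonal n c])
  <->
  (exists v : vertex,
     nontrivial_component (component v) /\ m = representation n v).
Proof.
have pred_rank (k : int) : 1 <= k -> exists a : nat, k = a%:Z + 1.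
  by move=> ?; exists (absz (k - 1)); lia.
split=> [[_ [_ [_ [/pred_rank[a ->] /pred_rank[b ->] /pred_rank[c ->] ->]]]]|].
  exists (pathP' a b c); split; first exact: nontrivial_pathP'.
  by rewrite representation_pathP'.
case=> _ [/nontrivial_on_pathP'[a [b [c ->]]] ->].
exists (a%:Z + 1), (b%:Z + 1), (c%:Z + 1).
by rewrite representation_pathP'; split; lia.
Qed.
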